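(* Let $(M,D)$ be an affine manifold of dimension $n$, let $N=T^*M$, let $g_N$ be the modified Riemannian extension metric on $N$, and let $\mathfrak{J}$ be the canonical almost para-Hermitian structure on $(N,g_N)$. Let $\pi\in\mathcal{P}(N)$. Then the eigenvalues of the para-complex Jacobi operator ${}^{g_N}\mathcal{J}(\pi)$ are $(1,\frac12)$ with multiplicities $(2,2n-2)$, respectively, and every Jordan block of ${}^{g_N}\mathcal{J}(\pi)$ has size at most $2\times2$. In particular, $(N,g_N,\mathfrak{J})$ is semi para-complex Osserman.
   Context: An affine manifold $(M,D)$ is a smooth $n$-dimensional manifold $M$ with a torsion-free connection $D$ on $TM$. For a pseudo-Riemannian metric $g$ with Levi-Civita connection $\nabla$, ${}^gR(X,Y)=\nabla_X\nabla_Y-\nabla_Y\nabla_X-\nabla_{[X,Y]}$ and ${}^g\mathcal{J}(X):Y\mapsto {}^gR(Y,X)X$. Modified Riemannian extension: let $N=T^*M$. Local coordinates $(x_1,\dots,x_n)$ on $M$ induce coordinates $(x_1,\dots,x_n,x_{1'},\dots,x_{n'})$ on $N$ by writing a 1-form as $\omega=x_{i'}dx^i$ (Einstein summation). Write $D_{\partial_{x_i}}\partial_{x_j}={}^D\Gamma_{ij}{}^k\partial_{x_k}$ and $u\circ v=\frac12(u\otimes v+v\otimes u)$. Then $g_N$ is the (globally well-defined) metric of neutral signature $(n,n)$ on $N$ given locally by $g_N=2\,dx^i\circ dx^{i'}+\{x_{i'}x_{j'}-2x_{k'}{}^D\Gamma_{ij}{}^k\}dx^i\circ dx^j$. The canonical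 almost para-Hermitian structure $\mathfrak{J}$ (an endomorphism of $TN$ with $\mathfrak{J}^2=\mathrm{Id}$ and $\mathfrak{J}^*g_N=-g_N$) is given locally by $\mathfrak{J}\partial_{x_i}=\partial_{x_i}-\{x_{i'}x_{j'}-2x_{k'}{}^D\Gamma_{ij}{}^k\}\partial_{x_{j'}}$, $\mathfrak{J}\partial_{x_{i'}}=-\partial_{x_{i'}}$. $\mathcal{P}(N)$ is the bundle over $N$ of $g_N$-non-degenerate $\mathfrak{J}$-invariant tangent 2-planes. For $\pi\in\mathcal{P}(N)$ choose $\xi\in\pi$ with $g_N(\xi,\xi)=1$; the para-complex Jacobi operator is ${}^{g_N}\mathcal{J}(\pi):={}^{g_N}\mathcal{J}(\xi)-{}^{g_N}\mathcal{J}(\mathfrak{J}\xi)$, which is independent of the choice of $\xi$. $(N,g_N,\mathfrak{J})$ is semi para-complex Osserman if ${}^{g_N}\mathcal{J}(\cdot)$ has constant eigenvalues on $\mathcal{P}(N)$. *)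

(* Defs.v *)
From HB Require Import structures.
From mathcomp Require Import all_boot all_order all_algebra.
From mathcomp Require Import all_classical all_reals.
From mathcomp Require Import topology normedtype derive.
From mathcomp Require Import complex ring.

Set Implicit Arguments.
Unset Strict Implicit.
Unset Printing Implicit Defensive.

Import Order.TTheory GRing.Theory Num.Theory.
Import numFieldNormedType.Exports.

Local Open Scope classical_set_scope.
Local Open Scope ring_scope.

(* Vectors of R^m are row vectors.  An endomorphism of R^m is given by the
   matrix acting on the right of row vectors, so that its i-th row is the image
   of the i-th basis vector; a bilinear form by its Gram matrix. *)

Section Smoothness.
Context {R : realType}.

(* All iterated partial derivatives of order at most k exist and are continuous
   on U; meaningful for open U, since the derivatives at x are two-sided. *)
Fixpoint Ck (k m : nat) (U : set 'rV[R]_m) (f : 'rV[R]_m -> R) : Prop :=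
  (forall x, U x -> {for x, continuous f}) /\
  match k with
  | 0 => True
  | k'.+1 => forall i : 'I_m,
      (forall x, U x -> derivable f x (delta_mx 0 i)) /\
      Ck k' U (fun x => 'D_(delta_mx 0 i) f x)
  end.

Definition smooth (m : nat) (U : set 'rV[R]_m) (f : 'rV[R]_m -> R) : Prop :=
  forall k, Ck k U f.

Definition smooth_map (m l : nat) (U : set 'rV[R]_m)
    (F : 'rV[R]_m -> 'rV[R]_l) : Prop :=
  forall i, smooth U (fun x => F x 0 i).

(* Vector fields on open subsets of R^m, in components. *)
Definition lie_bracket (m : nat) (X Y : 'rV[R]_m -> 'rV[R]_m) (x : 'rV[R]_m) :
    'rV[R]_m :=
  'D_(X x) Y x - 'D_(Y x) X x.

End Smoothness.

Record manifold (R : realType) (n : nat) := Manifold {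
  carrier :> topologicalType;
  manifold_hausdorff : hausdorff_space carrier;
  manifold_second_countable : @second_countable carrier;
  atlas : Type;
  dom : atlas -> set carrier;
  chart : atlas -> carrier -> 'rV[R]_n;
  chart_inv : atlas -> 'rV[R]_n -> carrier;
  dom_cover : forall m, exists c, dom c m;
  dom_open : forall c, open (dom c);
  chart_open : forall c, open (chart c @` dom c);
  chartK : forall c m, dom c m -> chart_inv c (chart c m) = m;
  chart_continuous : forall c m, dom c m -> {for m, continuous (chart c)};
  chart_inv_continuous : forall c x, (chart c @` dom c) x ->
    {for x, continuous (chart_inv c)};
  transition_smooth : forall c c',
    smooth_map (chart c @` (dom c `&` dom c')) (chart c' \o chart_inv c)
}.

Section AffineManifold.
Context {R : realType} {n : nat}.

Definition transition (M : manifold R n) (c c' : atlas M) :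
    'rV[R]_n -> 'rV[R]_n :=
  chart c' \o chart_inv c.

Definition chart_image (M : manifold R n) (c : atlas M) : set 'rV[R]_n :=
  chart c @` dom c.

(* The components X' of a vector field in chart c' and X in chart c agree
   over W. *)
Definition same_field (M : manifold R n) (c c' : atlas M) (W : set 'rV[R]_n)
    (X X' : 'rV[R]_n -> 'rV[R]_n) : Prop :=
  forall x, W x -> X' (transition c c' x) = 'D_(X x) (transition c c') x.

(* A torsion-free connection D on TM, acting on smooth vector fields over any
   open subset of a chart domain: [cov c X Y] is D_X Y, all fields being given
   by their components in chart c as functions of the coordinates.
   [cov_chart] says that the operators so obtained agree on overlaps. *)
Record connection (M : manifold R n) := Connection {
  cov : atlas M -> ('rV[R]_n -> 'rV[R]_n) -> ('rV[R]_n -> 'rV[R]_n) ->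
    'rV[R]_n -> 'rV[R]_n;
  cov_smooth : forall c W X Y, open W -> W `<=` chart_image c ->
    smooth_map W X -> smooth_map W Y -> smooth_map W (cov c X Y);
  cov_linear : forall c W X X' Y f, open W -> W `<=` chart_image c ->
    smooth_map W X -> smooth_map W X' -> smooth_map W Y -> smooth W f ->
    forall x, W x ->
      cov c (fun y => f y *: X y + X' y) Y x = f x *: cov c X Y x + cov c X' Y x;
  cov_additive : forall c W X Y Y', open W -> W `<=` chart_image c ->
    smooth_map W X -> smooth_map W Y -> smooth_map W Y' ->
    forall x, W x ->
      cov c X (fun y => Y y + Y' y) x = cov c X Y x + cov c X Y' x;
  cov_leibniz : forall c W X Y f, open W -> W `<=` chart_image c ->
    smooth_map W X -> smooth_map W Y -> smooth W f ->
    forall x, W x ->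
      cov c X (fun y => f y *: Y y) x = 'D_(X x) f x *: Y x + f x *: cov c X Y x;
  cov_chart : forall c c' W X Y X' Y', open W ->
    W `<=` chart c @` (dom c `&` dom c') ->
    smooth_map W X -> smooth_map W Y ->
    smooth_map (transition c c' @` W) X' ->
    smooth_map (transition c c' @` W) Y' ->
    same_field c c' W X X' -> same_field c c' W Y Y' ->
    same_field c c' W (cov c X Y) (cov c' X' Y');
  cov_torsion_free : forall c W X Y, open W -> W `<=` chart_image c ->
    smooth_map W X -> smooth_map W Y ->
    forall x, W x -> cov c X Y x - cov c Y X x = lie_bracket X Y x
}.

(* The coefficient of the k-th coordinate field in D_{d_i} d_j. *)
Definition Dchristoffel (M : manifold R n) (D : connection M) (c : atlas M)
    (x : 'rV[R]_n) (i j k : 'I_n) : R :=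
  cov D c (fun=> delta_mx 0 i) (fun=> delta_mx 0 j) x 0 k.

(* A point of the cotangent bundle N = T*M: a point m of M and a 1-form at m,
   given by its components in all charts at m.  The last field says that the
   value of the 1-form on a tangent vector at m does not depend on the chart. *)
Record cotangent (M : manifold R n) := Cotangent {
  foot : M;
  covector : atlas M -> 'rV[R]_n;
  covector_chart : forall c c', dom c foot -> dom c' foot ->
    forall v : 'rV[R]_n,
      v *m (covector c)^T =
      'D_v (transition c c') (chart c foot) *m (covector c')^T
}.

(* The induced coordinates (x_1, ..., x_n, x_1', ..., x_n') on N. *)
Definition cotangent_chart (M : manifold R n) (c : atlas M)
    (w : cotangent M) : 'rV[R]_(n + n) :=
  row_mx (chart c (foot w)) (covector w c).

(* The matrix x_i' x_j' - 2 x_k' Gamma_ij^k. *)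
Definition extension_form (M : manifold R n) (D : connection M) (c : atlas M)
    (p : 'rV[R]_(n + n)) : 'M[R]_n :=
  \matrix_(i, j) (rsubmx p 0 i * rsubmx p 0 j -
    2 * \sum_k rsubmx p 0 k * Dchristoffel D c (lsubmx p) i j k).

(* The modified Riemannian extension g_N in the coordinates induced by c; the
   off-diagonal blocks are 2 dx^i o dx^i' = dx^i (x) dx^i' + dx^i' (x) dx^i. *)
Definition gN (M : manifold R n) (D : connection M) (c : atlas M)
    (p : 'rV[R]_(n + n)) : 'M[R]_(n + n) :=
  block_mx (extension_form D c p) 1%:M 1%:M 0.

Definition JN (M : manifold R n) (D : connection M) (c : atlas M)
    (p : 'rV[R]_(n + n)) : 'M[R]_(n + n) :=
  block_mx 1%:M (- extension_form D c p) 0 (- 1%:M).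

End AffineManifold.

Section PseudoRiemannian.
Context {R : realType} {m : nat}.

Definition form (G : 'M[R]_m) (u v : 'rV[R]_m) : R := (u *m G *m v^T) 0 0.

Variable g : 'rV[R]_m -> 'M[R]_m.

Definition partial_g (k i j : 'I_m) (p : 'rV[R]_m) : R :=
  'D_(delta_mx 0 k) (fun q => g q i j) p.

(* Christoffel symbols of the Levi-Civita connection of g, see
   [levi_civita_sym] and [levi_civita_metric]. *)
Definition levi_civita (p : 'rV[R]_m) (i j k : 'I_m) : R :=
  2^-1 * \sum_l (partial_g i j l p + partial_g j i l p - partial_g l i j p) *
    invmx (g p) l k.

Definition nabla (X Y : 'rV[R]_m -> 'rV[R]_m) (p : 'rV[R]_m) : 'rV[R]_m :=
  'D_(X p) Y p +
  \row_k \sum_i \sum_j X p 0 i * Y p 0 j * levi_civita p i j k.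

Definition curvature (X Y Z : 'rV[R]_m -> 'rV[R]_m) (p : 'rV[R]_m) :
    'rV[R]_m :=
  nabla X (nabla Y Z) p - nabla Y (nabla X Z) p - nabla (lie_bracket X Y) Z p.

(* Y |-> R(Y, X) X at p; as R is tensorial, tangent vectors may be extended to
   fields with constant components. *)
Definition jacobi (p x y : 'rV[R]_m) : 'rV[R]_m :=
  curvature (fun=> y) (fun=> x) (fun=> x) p.

Lemma levi_civita_sym (p : 'rV[R]_m) (i j k : 'I_m) :
  (forall q, (g q)^T = g q) -> levi_civita p i j k = levi_civita p j i k.
Proof.
move=> gsym; rewrite /levi_civita; congr (_ * _); apply: eq_bigr => l _.
have -> : partial_g l i j p = partial_g l j i p.
  rewrite /partial_g; congr ('D__ _ p); apply/funext => q.
  by rewrite -[in LHS]gsym mxE.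
by rewrite [partial_g i j l p + _]addrC.
Qed.

Lemma levi_civita_metric (p : 'rV[R]_m) (k i j : 'I_m) :
  (forall q, (g q)^T = g q) -> g p \in unitmx ->
  \sum_l levi_civita p k i l * g p l j + \sum_l levi_civita p k j l * g p i l =
  partial_g k i j p.
Proof.
move=> gsym gunit.
have gE q a b : g q a b = g q b a by rewrite -[in LHS]gsym mxE.
have pE a b c : partial_g a b c p = partial_g a c b p.
  by rewrite /partial_g; congr ('D__ _ p); apply/funext => q.
have lower a b c : \sum_l levi_civita p a b l * g p l c =
    2^-1 * (partial_g a b c p + partial_g b a c p - partial_g c a b p).
  under eq_bigr do rewrite -mulrA mulr_suml.
  rewrite -mulr_sumr exchange_big /=; congr (_ * _).
  under eq_bigr => l _.
    under eq_bigr do rewrite -mulrA.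
    rewrite -mulr_sumr.
    have -> : \sum_h invmx (g p) l h * g p h c = (invmx (g p) *m g p) l c.
      by rewrite mxE.
    rewrite mulVmx // mxE mulr_natr; over.
  rewrite (bigD1 c) //= eqxx mulr1n big1 ?addr0 // => l /negbTE ->.
  by rewrite mulr0n.
rewrite lower; under eq_bigr do rewrite gE; rewrite lower -mulrDr.
rewrite (pE k j i) (pE j k i) (pE i k j).
set a := partial_g _ _ _ _; set b := partial_g _ _ _ _.
set c := partial_g _ _ _ _.
have -> : a + b - c + (a + c - b) = 2 * a.
  by ring.
by rewrite mulKf // pnatr_eq0.
Qed.

End PseudoRiemannian.

Section ParaComplexOsserman.
Context {R : realType} {n : nat}.

(* An element of P(N): a point of N, a chart of M around its foot point, and,
   in the induced coordinates, a g_N-non-degenerate J-invariant 2-plane in the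
   tangent space of N at that point. *)
Record para_plane (M : manifold R n) (D : connection M) := ParaPlane {
  pt : cotangent M;
  pl_chart : atlas M;
  pl_dom : dom pl_chart (foot pt);
  plane : {vspace 'rV[R]_(n + n)};
  plane_dim : \dim plane = 2%N;
  plane_invariant : forall u, u \in plane ->
    u *m JN D pl_chart (cotangent_chart pl_chart pt) \in plane;
  plane_nondegenerate : forall u, u \in plane ->
    (forall v, v \in plane ->
       form (gN D pl_chart (cotangent_chart pl_chart pt)) u v = 0) ->
    u = 0
}.

Definition pl_pt (M : manifold R n) (D : connection M) (pi : para_plane D) :
    'rV[R]_(n + n) :=
  cotangent_chart (pl_chart pi) (pt pi).

Definition unit_vector (M : manifold R n) (D : connection M)
    (pi : para_plane D) (xi : 'rV[R]_(n + n)) : Prop :=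
  xi \in plane pi /\ form (gN D (pl_chart pi) (pl_pt pi)) xi xi = 1.

Lemma gN_sym (M : manifold R n) (D : connection M) (c : atlas M)
    (p : 'rV[R]_(n + n)) :
  chart_image c (lsubmx p) -> (gN D c p)^T = gN D c p.
Proof.
move=> cp; rewrite /gN tr_block_mx !trmx1 trmx0; congr block_mx.
apply/matrixP => i j; rewrite !mxE [X in X - _ = _]mulrC; congr (_ - 2 * _).
apply: eq_bigr => k _; congr (_ * _).
have sc (v : 'rV[R]_n) : smooth_map (chart_image c) (fun=> v).
  move=> l; suff H : forall q (a : R), Ck q (chart_image c) (fun=> a).
    by move=> q; apply: H.
  elim=> [|q IH] a; split=> //; try by move=> x _; exact: cst_continuous.
  move=> h; split; first by move=> x _; exact: derivable_cst.
  have -> : (fun x : 'rV[R]_n => 'D_(delta_mx 0 h) (fun=> a) x) = (fun=> 0).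
    by apply/funext => x; rewrite derive_cst.
  exact: IH.
have /(_ _ cp) := cov_torsion_free D (@chart_open _ _ M c) (@subset_refl _ _)
  (sc (delta_mx 0 j)) (sc (delta_mx 0 i)).
rewrite /lie_bracket !derive_cst subrr => /eqP; rewrite subr_eq0 => /eqP E.
by rewrite /Dchristoffel E.
Qed.

Lemma JN_anti_isometry (M : manifold R n) (D : connection M) (c : atlas M)
    (p u v : 'rV[R]_(n + n)) : chart_image c (lsubmx p) ->
  form (gN D c p) (u *m JN D c p) (v *m JN D c p) = - form (gN D c p) u v.
Proof.
move=> cp.
have := gN_sym D cp; rewrite [X in X^T]/gN tr_block_mx.
move=> /eq_block_mx[hT _ _ _].
have JgJ : JN D c p *m gN D c p *m (JN D c p)^T = - gN D c p.
  rewrite /JN /gN tr_block_mx !linearN /= hT !trmx1 trmx0 !mulmx_block.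
  rewrite opp_block_mx !(mul1mx, mulmx1, mul0mx, mulmx0, mulNmx, mulmxN).
  by rewrite !(mul1mx, mul0mx, addr0, add0r, subrr, oppr0, sub0r, subr0).
have -> : form (gN D c p) (u *m JN D c p) (v *m JN D c p) =
    form (JN D c p *m gN D c p *m (JN D c p)^T) u v.
  by rewrite /form trmx_mul !mulmxA.
by rewrite JgJ /form mulmxN mulNmx mxE.
Qed.

(* Every plane in P(N) contains a unit vector. *)
Lemma unit_vector_exists (M : manifold R n) (D : connection M)
    (pi : para_plane D) : exists xi, unit_vector pi xi.
Proof.
have cp : chart_image (pl_chart pi) (lsubmx (pl_pt pi)).
  by rewrite row_mxKl; exists (foot (pt pi)) => //; exact: pl_dom.
set G := gN D (pl_chart pi) (pl_pt pi).
have GC u v : form G u v = form G v u.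
  rewrite /form.
  have <- : (u *m G *m v^T)^T = v *m G *m u^T.
    by rewrite !trmx_mul trmxK (gN_sym D cp) mulmxA.
  by rewrite [RHS]mxE.
have GD u u' v : form G (u + u') v = form G u v + form G u' v.
  by rewrite /form !mulmxDl mxE.
have GZ a u v : form G (a *: u) v = a * form G u v.
  by rewrite /form -!scalemxAl mxE.
have pos u : u \in plane pi -> 0 < form G u u ->
    exists xi, unit_vector pi xi.
  move=> uP u0; exists ((Num.sqrt (form G u u))^-1 *: u); split.
    exact: memvZ.
  rewrite -/G GZ GC GZ -[X in _ * (_ * X)]sqr_sqrtr ?ltW // expr2 mulKf.
    by rewrite mulVf // sqrtr_eq0 -ltNge.
  by rewrite sqrtr_eq0 -ltNge.
apply: contrapT => nex.
have null u : u \in plane pi -> form G u u = 0.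
  move=> uP; case: (ltgtP 0 (form G u u)) => // [/(pos u uP)//|lt0].
  case: nex; apply: (pos (u *m JN D (pl_chart pi) (pl_pt pi))).
    exact: plane_invariant.
  by rewrite JN_anti_isometry // oppr_gt0.
have nd := plane_nondegenerate (p := pi).
have z u : u \in plane pi -> u = 0.
  move=> uP; apply: nd => // v vP; rewrite -/(pl_pt pi) -/G.
  have := null _ (memvD uP vP).
  rewrite GD !(GC _ (u + v)) !GD !null // add0r addr0 (GC v u) -mulr2n.
  by move/eqP; rewrite mulrn_eq0 /= => /eqP.
have := plane_dim pi; suff -> : plane pi = 0%VS by rewrite dimv0.
by apply/eqP; rewrite -subv0; apply/subvP => u /z ->; rewrite mem0v.
Qed.

(* The matrix of the para-complex Jacobi operator of pi, computed from the unit
   vector xi of pi. *)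
Definition para_jacobi (M : manifold R n) (D : connection M)
    (pi : para_plane D) (xi : 'rV[R]_(n + n)) : 'M[R]_(n + n) :=
  let g := gN D (pl_chart pi) in
  let J := JN D (pl_chart pi) (pl_pt pi) in
  lin1_mx (fun y => jacobi g (pl_pt pi) xi y - jacobi g (pl_pt pi) (xi *m J) y).

Definition complexify (d : nat) (A : 'M[R]_d) : 'M[R[i]]_d :=
  map_mx (real_complex R) A.

Definition multiplicity (F : fieldType) (d : nat) (A : 'M[F]_d) (z : F) : nat :=
  mup z (char_poly A).

Definition semi_para_complex_osserman (M : manifold R n) (D : connection M) :
    Prop :=
  forall (pi pi' : para_plane D) (xi xi' : 'rV[R]_(n + n)),
    unit_vector pi xi -> unit_vector pi' xi' ->
    forall z : R[i],
      multiplicity (complexify (para_jacobi pi xi)) z =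
      multiplicity (complexify (para_jacobi pi' xi')) z.

End ParaComplexOsserman.

Section Jordan.
Variable F : fieldType.

Definition jordan_block (k : nat) (z : F) : 'M[F]_k :=
  \matrix_(i, j) (z *+ (i == j) + (i.+1 == j :> nat)%:R).

(* The s blocks, of sizes k i and eigenvalues z i, form a Jordan normal form of
   A.  P and Q are mutually inverse; they are rectangular in type only. *)
Definition jordan_normal_form (d : nat) (A : 'M[F]_d) (s : nat)
    (k : 'I_s -> nat) (z : 'I_s -> F) : Prop :=
  (forall i, (0 < k i)%N) /\
  exists (P : 'M[F]_(d, \sum_i k i)) (Q : 'M[F]_(\sum_i k i, d)),
    [/\ P *m Q = 1%:M, Q *m P = 1%:M &
        A = P *m (\mxdiag_i jordan_block (k i) (z i)) *m Q].

End Jordan.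

(* Main.v *)
(** Write a unit vector of the plane as xi = (a, b), with [a] its horizontal and
    [b] its vertical part.  Then xi - J xi = w = (0, c) is vertical, where
    c = 2 b + a E and [E] is the matrix x_i' x_j' - 2 x_k' Gamma_ij^k, and
    g_N(xi, xi) = 1 means a . c = 1.  In the difference of the Jacobi operators
    of xi and xi - w every term without [w] cancels.  Since the vertical
    distribution is totally null and parallel, what is left in the diagonal
    blocks only involves the second vertical derivatives of [E], in which the
    connection does not appear.  The para-complex Jacobi operator is therefore
    block triangular with diagonal blocks P and P^T, where
    P = (1 + c^T a) / 2 has eigenvalues 1 (once) and 1/2 (n - 1 times) and
    satisfies (P - 1) (P - 1/2) = 0; the off-diagonal block is arbitrary. *)

Require Import Defs.
From HB Require Import structures.
From mathcomp Require Import all_boot all_order all_algebra.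
From mathcomp Require Import all_classical all_reals.
From mathcomp Require Import topology normedtype landau derive.
From mathcomp Require Import complex ring.

Set Implicit Arguments.
Unset Strict Implicit.
Unset Printing Implicit Defensive.

Import Order.TTheory GRing.Theory Num.Theory.
Import numFieldNormedType.Exports.
Local Open Scope classical_set_scope.
Local Open Scope ring_scope.

(** * Rank-one perturbations of scalars and Jordan blocks *)

Section LinearAlgebra.

(** Matrix determinant lemma with an extra factor [t] on both sides, which avoids inverting [t]; it
    serves over a polynomial ring with [t = 'X - r%:P]. *)
Lemma det_scalar_subM (R : idomainType) (n : nat) (t : R) (u : 'cV[R]_n)
    (v : 'rV[R]_n) :
  t * \det (t%:M - u *m v) = t ^+ n * (t - (v *m u) 0 0).
Proof.
(* Compare the two Schur complements of B. *)
pose B : 'M_(n + 1) := block_mx t%:M u v 1%:M.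
have detB : \det B = \det (t%:M - u *m v).
  have := det_mulmx B (block_mx 1%:M 0 (- v) 1%:M).
  rewrite mulmx_block !mulmx1 !mulmx0 !add0r mulmxN mul1mx subrr.
  by rewrite det_ublock det_lblock !det1 !mulr1.
have := det_mulmx (block_mx 1%:M 0 (- v) t%:M : 'M_(n + 1)) B.
rewrite mulmx_block !mul1mx !mul0mx !addr0 mulmx1 mulNmx mul_mx_scalar.
rewrite mul_scalar_mx addNr det_ublock det_lblock detB !det_scalar expr1n.
by rewrite mul1r expr1 det_mx11 mulNmx !mxE => <-; rewrite eqxx mulr1n addrC.
Qed.

Lemma char_poly_block (R : comNzRingType) (m n : nat) (A : 'M[R]_m)
    (B : 'M[R]_(m, n)) (C : 'M[R]_n) :
  char_poly (block_mx A B 0 C) = char_poly A * char_poly C.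
Proof.
rewrite /char_poly /char_poly_mx map_block_mx map_mx0 scalar_mx_block.
by rewrite opp_block_mx add_block_mx oppr0 addr0 det_ublock.
Qed.

Lemma char_poly_trmx (R : comNzRingType) (n : nat) (A : 'M[R]_n) :
  char_poly A^T = char_poly A.
Proof.
rewrite /char_poly -[RHS]det_tr /char_poly_mx; congr (\det _).
by rewrite linearB /= tr_scalar_mx map_trmx.
Qed.

Variables (F : fieldType) (n : nat).

Lemma char_poly_scalarD_rank1 (r s : F) (u : 'cV[F]_n) (v : 'rV[F]_n) :
  (0 < n)%N -> v *m u = s%:M ->
  char_poly (r%:M + u *m v) = ('X - r%:P) ^+ n.-1 * ('X - (r + s)%:P).
Proof.
case: n u v => // m u v _ vu.
(* Both sides are multiplied by ['X - r%:P], the factor [t] of [det_scalar_subM]. *)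
apply: (mulfI (x := 'X - r%:P)); first by rewrite polyXsubC_eq0.
rewrite mulrA -exprS /char_poly.
have -> : char_poly_mx (r%:M + u *m v) =
    ('X - r%:P)%:M - map_mx polyC u *m map_mx polyC v.
  by rewrite /char_poly_mx map_mxD map_scalar_mx /= map_mxM opprD addrA raddfB.
rewrite det_scalar_subM -map_mxM vu map_scalar_mx /= mxE eqxx mulr1n.
by congr (_ * _); rewrite polyCD opprD addrA.
Qed.

(** [A] is annihilated by [(X - x)^2 (X - y)^2] with [x] and [y] distinct, so a block of size 3 or
    more is impossible: the first vector of a chain of length 3 would not be killed. *)
Lemma jordan_block_le2 (A : 'M[F]_n) (x y : F) :
  x != y ->
  let S := (A - x%:M) *m (A - y%:M) in S *m S = 0 ->
  forall (s : nat) (k : 'I_s -> nat) (z : 'I_s -> F),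
    jordan_normal_form A k z -> forall i, (k i <= 2)%N.
Proof.
move=> xy S SS s k z [_ [P [Q [PQ QP AE]]]] i.
rewrite {}/S in SS; set w := z i.
(* The rows of [Q] belonging to block [i]. As row vectors they are acted on from the right, and [A]
   acts on them by that block. *)
pose f : 'M_(k i, n) := submxcol Q i.
have fA : f *m A = jordan_block (k i) w *m f.
  have : Q *m A = (\mxdiag_i jordan_block (k i) (z i)) *m Q.
    by rewrite AE -!mulmxA mulmxA QP mul1mx.
  rewrite -[in RHS](submxcolK Q) mul_mxdiag_mxcol => QA.
  have := congr1 (fun B => submxcol B i) QA.
  by rewrite mxcolK submxcol_mul.
have f_neq0 j : row j f != 0.
  rewrite row_rowsub; set l := (X in row X Q); apply/eqP => l0.
  have := congr1 (mulmx (row l Q)) (erefl P); rewrite {1}l0 mul0mx -row_mul QP.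
  by move=> /rowP/(_ l)/esym/eqP; rewrite !mxE eqxx oner_eq0.
have fA_row j : row j f *m A =
    w *: row j f + \sum_(l < k i | j.+1 == l :> nat) row l f.
  rewrite -row_mul fA row_mul mulmx_sum_row.
  under eq_bigr do rewrite !mxE scalerDl -scalerMnl.
  rewrite big_split /=; congr (_ + _).
    rewrite (bigD1 j) //= eqxx big1 ?addr0 // => l.
    by rewrite eq_sym => /negbTE ->; rewrite mulr0n scale0r.
  rewrite [RHS]big_mkcond; apply: eq_bigr => l _.
  by case: eqP => _; rewrite ?scale1r ?scale0r.
rewrite leqNgt; apply/negP => k3.
have [m km] : exists m, k i = m.+3.
  by case: (k i) k3 => [|[|[|m]]] // _; exists m.
have lt_m r : (r < 3 -> m + r < k i)%N.
  by move=> r3; rewrite km -addn3 ltn_add2l.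
(* The last three rows of the block form a chain g 0, g 1, g 2 of generalized
   eigenvectors. *)
pose g r (r3 : (r < 3)%N) := row (Ordinal (lt_m r r3)) f.
have gA r (r3 : (r.+1 < 3)%N) :
    g r (ltnW r3) *m A = w *: g r (ltnW r3) + g r.+1 r3.
  rewrite fA_row; congr (_ + _).
  rewrite (big_pred1 (Ordinal (lt_m r.+1 r3))) // => l.
  by rewrite /= -val_eqE /= addnS eq_sym.
have gA_last : g 2 isT *m A = w *: g 2 isT.
  rewrite fA_row big_pred0 ?addr0 // => l /=.
  by apply/negbTE; rewrite neq_ltn addn2 -km ltn_ord orbT.
have := f_neq0 (Ordinal (lt_m 2 isT)); rewrite -/(g 2 isT).
move: (gA 0 isT) (gA 1 isT) gA_last.
rewrite (bool_irrelevance (ltnW (isT : (1 < 3)%N)) isT).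
rewrite (bool_irrelevance (ltnW (isT : (2 < 3)%N)) isT).
move: (g 0 isT) (g 1 isT) (g 2 isT) => g0 g1 g2 g0A g1A g2A g2_neq0.
have step c (h h' : 'rV[F]_n) : h *m A = w *: h + h' ->
    h *m (A - c%:M) = (w - c) *: h + h'.
  by move=> hA; rewrite mulmxBr hA mul_mx_scalar scalerBl addrAC.
have gA0 c := step c _ _ g0A.
have gA1 c := step c _ _ g1A.
have gA2 c : g2 *m (A - c%:M) = (w - c) *: g2.
  by rewrite (step c _ 0) ?addr0.
(* The two factors commute, so [killed] is available with either factor first. *)
have SE : (A - x%:M) *m (A - y%:M) = (A - y%:M) *m (A - x%:M).
  apply: comm_mxB; last exact: comm_mx_scalar.
  by apply: comm_mx_sym; apply: comm_mxB; [|exact: comm_mx_scalar].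
have killed (h : 'rV[F]_n) a b : a = x /\ b = y \/ a = y /\ b = x ->
    h *m (A - a%:M) *m (A - b%:M) *m (A - a%:M) *m (A - b%:M) = 0.
  by move=> [] [-> ->]; rewrite -!mulmxA !(mulmxA (A - _)) -?SE SS mulmx0.
(* If [w = a], the four factors send [g0] in turn to [g1], [(a - b) g1 + g2], [(a - b) g2] and
   [(a - b)^2 g2], which is nonzero. *)
have contra a b : a != b -> w = a -> a = x /\ b = y \/ a = y /\ b = x -> False.
  move=> ab wE /(killed g0); rewrite gA0 wE subrr scale0r add0r gA1 wE.
  rewrite mulmxDl -scalemxAl gA1 gA2 wE subrr !scale0r add0r addr0.
  rewrite -scalemxAl gA2 wE scalerA => /eqP.
  by rewrite scaler_eq0 (negbTE g2_neq0) mulf_eq0 subr_eq0 (negbTE ab).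
(* [g2] is an eigenvector, and the four factors multiply it by [((w - x) (w - y))^2]. *)
have : (w == x) || (w == y).
  have /(killed g2) : x = x /\ y = y \/ x = y /\ y = x by left.
  rewrite gA2 -!scalemxAl gA2 -!scalemxAl gA2 -!scalemxAl gA2.
  rewrite !scalerA => /eqP; rewrite scaler_eq0 (negbTE g2_neq0) orbF !mulf_eq0.
  by rewrite !subr_eq0; case: (w == x); case: (w == y).
case/orP => /eqP wE.
  by apply: (contra x y) => //; left.
by apply: (contra y x) => //; [rewrite eq_sym|right].
Qed.


(* The form taken by the para-complex Jacobi operator. *)
Definition rank1_block (a c : 'rV[F]_n) (B : 'M[F]_n) : 'M[F]_(n + n) :=
  let P := 2^-1%:M + 2^-1 *: (c^T *m a) in block_mx P B 0 P^T.

Lemma char_poly_rank1_block (a c : 'rV[F]_n) (B : 'M[F]_n) :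
  2 != 0 :> F -> a *m c^T = 1%:M -> (0 < n)%N ->
  char_poly (rank1_block a c B) =
  ('X - 2^-1%:P) ^+ (2 * n - 2) * ('X - 1%:P) ^+ 2.
Proof.
move=> F2 ac n_gt0; rewrite char_poly_block char_poly_trmx scalemxAl.
rewrite (@char_poly_scalarD_rank1 2^-1 2^-1) //; last first.
  by rewrite -scalemxAr ac scalemx1.
have -> : 2^-1 + 2^-1 = 1 :> F by rewrite -div1r -mulrDl divff.
rewrite mulrACA -!expr2 -exprM; congr (_ ^+ _ * _).
by rewrite muln2 -subn1 doubleB mul2n.
Qed.

(** Since [a *m c^T = 1], the matrix [N = c^T a / 2] satisfies [N^2 = N / 2]. Hence both diagonal
    blocks of [S] vanish, and [S], having only an upper right block, squares to zero. *)
Lemma rank1_block_annihilated (a c : 'rV[F]_n) (B : 'M[F]_n) :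
  2 != 0 :> F -> a *m c^T = 1%:M ->
  let A := rank1_block a c B in
  let S := (A - 1%:M) *m (A - 2^-1%:M) in S *m S = 0.
Proof.
move=> F2 ac A S.
have half : 2^-1 + 2^-1 = 1 :> F by rewrite -div1r -mulrDl divff.
pose N := 2^-1 *: (c^T *m a).
have NN : N *m N = 2^-1 *: N.
  by rewrite -scalemxAl -scalemxAr mulmxA -[c^T *m a *m _]mulmxA ac mulmx1.
have N0 : (2^-1%:M + N - 1%:M) *m (2^-1%:M + N - 2^-1%:M) = 0.
  rewrite [_ + N - 2^-1%:M]addrAC subrr add0r mulmxBl mulmxDl mul1mx NN.
  by rewrite mul_scalar_mx -scalerDl half scale1r subrr.
have N0T : ((2^-1%:M + N)^T - 1%:M) *m ((2^-1%:M + N)^T - 2^-1%:M) = 0.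
  have trB t : (2^-1%:M + N)^T - t%:M = (2^-1%:M + N - t%:M)^T.
    by rewrite [RHS]linearB /= tr_scalar_mx.
  rewrite !trB.
  rewrite -trmx_mul [_ + N - 2^-1%:M]addrAC subrr add0r mulmxBr mulmxDr mulmx1.
  by rewrite NN mul_mx_scalar -scalerDl half scale1r subrr trmx0.
rewrite /S /A /rank1_block -/N !(scalar_mx_block n n) !opp_block_mx.
rewrite !add_block_mx.
rewrite !oppr0 !addr0 !mulmx_block !mulmx0 !mul0mx !addr0 !add0r N0 N0T.
by rewrite !mulmx0 !mul0mx !addr0 block_mx0.
Qed.

End LinearAlgebra.

(** * Continuously differentiable functions *)

Section Calculus.
Context {R : realType}.

Lemma differentiable_bigsum (V : normedModType R) (I : Type) (r : seq I)
    (f : I -> V -> R) (x : V) :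
  (forall i, differentiable (f i) x) ->
  differentiable (fun u => \sum_(i <- r) f i u) x.
Proof.
move=> df; elim: r => [|i r IH].
  by under eq_fun do rewrite big_nil; exact: differentiable_cst.
by under eq_fun do rewrite big_cons; exact: differentiableD.
Qed.

Lemma is_derive_bigsum (V : normedModType R) (I : Type) (r : seq I)
    (f : I -> V -> R) (df : I -> R) (x v : V) :
  (forall i, is_derive x v (f i) (df i)) ->
  is_derive x v (fun u => \sum_(i <- r) f i u) (\sum_(i <- r) df i).
Proof.
move=> fP; elim: r => [|i r IH].
  by under eq_fun do rewrite big_nil; rewrite big_nil; exact: is_derive_cst.
by under eq_fun do rewrite big_cons; rewrite big_cons; exact: is_deriveD.
Qed.

Lemma is_derive_cstM (V : normedModType R) (f : V -> R) (a df : R) (x v : V) :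
  is_derive x v f df -> is_derive x v (fun u => a * f u) (a * df).
Proof. exact: is_deriveZ. Qed.

(** [diff_locallyP] is phrased with the canonical differential; [diff_unique] identifies it with the
    candidate [D]. *)
Lemma differentiable_littleo (V W : normedModType R) (f : V -> W) (x : V)
    (D : {linear V -> W}) :
  continuous D ->
  (forall eps : R, 0 < eps ->
    \forall v \near 0, `|f (v + x) - f x - D v| <= eps * `|v|) ->
  differentiable f x.
Proof.
move=> Dcont fD.
suff E : f \o shift x = cst (f x) + D +o_ 0 id.
  by apply/diff_locallyP; rewrite (diff_unique Dcont E).
apply/eqaddoP => eps eps0; near=> v.
by rewrite !fctE /= opprD addrA; near: v; exact: fD.
Unshelve. all: by end_near. Qed.

Lemma mx_norm_coord (m : nat) (v : 'rV[R]_m) (i : 'I_m) : `|v 0 i| <= `|v|.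
Proof.
by rewrite {2}/Num.Def.normr /= mx_normrE; apply: (le_bigmax _ _ (0, i)).
Qed.

Lemma mx_norm_le (m : nat) (v : 'rV[R]_m) (e : R) :
  0 <= e -> (forall i, `|v 0 i| <= e) -> `|v| <= e.
Proof.
move=> e0 ve; rewrite /Num.Def.normr /= mx_normrE.
by apply: bigmax_le => // -[i j] _ /=; rewrite ord1.
Qed.

(** Mean value theorem on the line through [y] in direction [e]. Bounding [s] by the absolute value
    of [t] covers both signs, treated on [[0, t]] and [[t, 0]]. *)
Lemma partial_mvt (m : nat) (f : 'rV[R]_m -> R) (y e : 'rV[R]_m) (t : R) :
  (forall s : R, `|s| <= `|t| -> derivable f (s *: e + y) e) ->
  exists2 s : R, `|s| <= `|t| & f (t *: e + y) - f y = t * 'D_e f (s *: e + y).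
Proof.
move=> df; pose g (s : R) := f (s *: e + y).
have quot s : (fun h : R => h^-1 *: ((g \o shift s) (h *: 1) - g s)) =
    (fun h : R =>
       h^-1 *: ((f \o shift (s *: e + y)) (h *: e) - f (s *: e + y))).
  by apply/funext => h; rewrite /g /= [h *: 1]mulr1 scalerDl addrA.
have dg (s : R) : `|s| <= `|t| -> is_derive s 1 g ('D_e f (s *: e + y)).
  by move=> /df dfs; split; rewrite /derivable /derive quot.
have gc a b : (forall s : R, s \in `[a, b] -> `|s| <= `|t|) ->
    {within `[a, b], continuous g}.
  by move=> ab; apply: derivable_within_continuous => s /ab/dg[].
have g0 : g 0 = f y by rewrite /g scale0r add0r.
have [t0|t0] := leP 0 t.
  have bd (s : R) : s \in `[0, t] -> `|s| <= `|t|.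
    by rewrite in_itv /= => /andP[s0 st]; rewrite !ger0_norm.
  have [||s /bd st E] := @MVT_segment R g (fun s => 'D_e f (s *: e + y)) 0 t t0.
  - by move=> s /subset_itv_oo_cc /bd /dg.
  - exact: gc.
  by exists s => //; rewrite -g0 E subr0 mulrC.
have bd (s : R) : s \in `[t, 0] -> `|s| <= `|t|.
  by rewrite in_itv /= => /andP[s0 st]; rewrite !ler0_norm ?lerN2 // ltW.
have [||s /bd st E] :=
  @MVT_segment R g (fun s => 'D_e f (s *: e + y)) t 0 (ltW t0).
- by move=> s /subset_itv_oo_cc /bd /dg.
- exact: gc.
by exists s => //; rewrite -g0 -[LHS]opprB E sub0r mulrN opprK mulrC.
Qed.

(** The increment of [f] is telescoped over the coordinates and each step is evaluated by
    [partial_mvt]; continuity of the partial derivatives bounds each error. *)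
Lemma continuous_partials_differentiable (m : nat) (f : 'rV[R]_m -> R)
    (x : 'rV[R]_m) :
  (\forall y \near x, forall i, derivable f y (delta_mx 0 i)) ->
  (forall i, {for x, continuous (fun y => 'D_(delta_mx 0 i) f y)}) ->
  differentiable f x.
Proof.
move=> df cf.
have [D Dlin] : exists D : {linear 'rV[R]_m -> R}, 
    forall v, D v = \sum_i v 0 i * 'D_(delta_mx 0 i) f x.
  pose D (v : 'rV[R]_m) : R := \sum_i v 0 i * 'D_(delta_mx 0 i) f x.
  have Dl : linear D.
    move=> a u v; rewrite /D scaler_sumr -big_split /=.
    by apply: eq_bigr => i _; rewrite !mxE mulrDl -mulrA.
  pose M := GRing.isLinear.Build _ _ _ _ _ Dl.
  pose DL : {linear 'rV[R]_m -> R} := HB.pack D M.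
  by exists DL.
have Dcont : continuous D.
  move=> v; apply: differentiable_continuous.
  rewrite (_ : (D : 'rV[R]_m -> R) =
    fun u => \sum_i u 0 i * 'D_(delta_mx 0 i) f x); last exact/funext.
  apply: differentiable_bigsum => i.
  apply: differentiableM; first exact: differentiable_coord.
  exact: differentiable_cst.
apply: (differentiable_littleo Dcont) => eps eps_gt0.
(* The divisor [m.+1] is nonzero even for [m = 0], and [m] errors of size [e * |v|] still add up to
   at most [eps * |v|]. *)
pose e := eps / m.+1%:R.
have e_gt0 : 0 < e by rewrite divr_gt0.
have : \forall y \near x, forall i, derivable f y (delta_mx 0 i) /\
    `|'D_(delta_mx 0 i) f x - 'D_(delta_mx 0 i) f y| <= e.
  near=> y => i; split; first by move: i; near: y.
  move: i; near: y; apply: filter_forall => i.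
  by move/cvgrPdist_le : (cf i); apply.
move=> /nbhs_ballP[d /= d0 dP].
apply/nbhs_ballP; exists d => //= v; rewrite -ball_normE /= sub0r normrN => vd.
(* Move from x to x + v one coordinate at a time; as the norm is the sup norm,
   the path stays in the ball. *)
pose tr k : 'rV[R]_m := \row_i (if (i < k)%N then v 0 i else 0).
have trS (k : 'I_m) : tr k.+1 = v 0 k *: delta_mx 0 k + tr k.
  apply/rowP => i; rewrite !mxE eqxx /= ltnS -val_eqE /=.
  by case: ltngtP => [||/val_inj->]; rewrite ?(mulr0, mulr1, add0r, addr0).
have tr0 : tr 0 = 0 by apply/rowP => i; rewrite !mxE.
have trm : tr m = v by apply/rowP => i; rewrite !mxE ltn_ord.
have near_tr (k : 'I_m) s : `|s| <= `|v 0 k| ->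
    ball x d (s *: delta_mx 0 k + (tr k + x)).
  move=> sv; rewrite -ball_normE /= addrA opprD addrCA subrr addr0 normrN.
  apply: le_lt_trans vd; apply: mx_norm_le => // i.
  rewrite !mxE eqxx /= -val_eqE /=.
  case: ltngtP => [||_]; rewrite ?(mulr0, mulr1, add0r, addr0, normr0) //.
    by move=> _; exact: mx_norm_coord.
  exact: le_trans sv (mx_norm_coord _ _).
have term (k : 'I_m) :
    `|f (tr k.+1 + x) - f (tr k + x) - v 0 k * 'D_(delta_mx 0 k) f x|
    <= e * `|v|.
  have [s sv] : exists2 s : R, `|s| <= `|v 0 k| &
      f (v 0 k *: delta_mx 0 k + (tr k + x)) - f (tr k + x) =
      v 0 k * 'D_(delta_mx 0 k) f (s *: delta_mx 0 k + (tr k + x)).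
    by apply: partial_mvt => s /near_tr /dP /(_ k)[].
  rewrite trS -[_ + tr k + x]addrA => ->; rewrite -mulrBr normrM mulrC distrC.
  apply: ler_pM => //; last exact: mx_norm_coord.
  by have /near_tr /dP /(_ k)[] := sv.
have -> : f (v + x) - f x - D v =
    \sum_(k < m)
      (f (tr k.+1 + x) - f (tr k + x) - v 0 k * 'D_(delta_mx 0 k) f x).
  rewrite sumrB -(big_mkord xpredT (fun k => f (tr k.+1 + x) - f (tr k + x))).
  rewrite (telescope_sumr (fun k => f (tr k + x))) // tr0 trm add0r -Dlin //.
apply: le_trans (ler_norm_sum _ _ _) _.
apply: (@le_trans _ _ (\sum_(k < m) e * `|v|)); first exact: ler_sum.
rewrite sumr_const card_ord -[leLHS]mulr_natr mulrAC /=; apply: ler_wpM2r => //.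
by rewrite /e mulrAC ler_pdivrMr // ler_wpM2l ?(ltW eps_gt0) // ler_nat.
Unshelve. all: by end_near. Qed.

End Calculus.

(** * Smooth functions on open sets and functions of one block of coordinates *)

Section Smooth.
Context {R : realType}.

(** The differential of [f] serves for [g]. Agreement near [x] is what is at hand later: the
    formulas for derivatives of [g_N] hold over the image of the chart. *)
Lemma near_eq_differentiable (V W : normedModType R) (f g : V -> W) (x : V) :
  (\near x, f x = g x) -> differentiable f x -> differentiable g x.
Proof.
move=> fg df; apply: (differentiable_littleo (diff_continuous df)) => eps eps0.
have /(_ _ eps0) fE := (eqaddoP _ _ _ _).1 (diff_locally df).
have fg0 := nbhs_singleton fg.
have gf : \forall v \near 0, f (v + x) = g (v + x).
  have : v + x @[v --> (0 : V)] --> x.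
    rewrite -[X in _ --> X]add0r.
    by apply: cvgD; [exact: cvg_id|exact: cvg_cst].
  by move/(_ _ fg).
near=> v.
have <- : f (v + x) = g (v + x) by near: v.
rewrite -fg0; have : `|(f \o shift x - (cst (f x) + 'd f x)) v| <= eps * `|v|.
  by near: v.
by rewrite !fctE /= opprD addrA.
Unshelve. all: by end_near. Qed.

Lemma smooth_cst (m : nat) (U : set 'rV[R]_m) (a : R) : smooth U (fun=> a).
Proof.
move=> k; elim: k a => [|k IH] a; split=> //;
  try by move=> x _; exact: cst_continuous.
move=> i; split; first by move=> x _; exact: derivable_cst.
have -> : (fun x : 'rV[R]_m => 'D_(delta_mx 0 i) (fun=> a) x) = (fun=> 0).
  by apply/funext => x; rewrite derive_cst.
exact: IH.
Qed.

Lemma smooth_partial (m : nat) (U : set 'rV[R]_m) (f : 'rV[R]_m -> R)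
    (i : 'I_m) :
  smooth U f -> smooth U (fun x => 'D_(delta_mx 0 i) f x).
Proof. by move=> sf k; have [_ /(_ i)[]] := sf k.+1. Qed.

(** Passage from the partial derivatives of [Ck] to Fréchet differentiability; order one
    suffices. *)
Lemma smooth_differentiable (m : nat) (U : set 'rV[R]_m) (f : 'rV[R]_m -> R)
    (x : 'rV[R]_m) :
  open U -> smooth U f -> U x -> differentiable f x.
Proof.
move=> oU sf Ux; have [_ df] := sf 1%N.
apply: continuous_partials_differentiable.
  have := open_nbhs_nbhs (conj oU Ux); apply: filterS => y Uy i.
  by have [+ _] := df i; apply.
by move=> i; have [_ [+ _]] := df i; apply.
Qed.

Lemma derive_comp_lsubmx (n1 n2 : nat) (f : 'rV[R]_n1 -> R)
    (q v : 'rV[R]_(n1 + n2)) :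
  'D_v (fun q => f (lsubmx q)) q = 'D_(lsubmx v) f (lsubmx q).
Proof.
rewrite /derive.
set F := (X in lim (X @ _) = _); set G := (X in _ = lim (X @ _)).
suff -> : F = G by [].
apply/funext => h; rewrite /F /G /=; congr (_ *: (f _ - _)).
by apply/rowP => j; rewrite !mxE.
Qed.

Lemma is_derive_rsubmx_coord (n1 n2 : nat) (i : 'I_n2)
    (q v : 'rV[R]_(n1 + n2)) :
  is_derive q v (fun q => rsubmx q 0 i) (rsubmx v 0 i).
Proof.
split.
  apply: diff_derivable.
  exact: (differentiable_comp (differentiable_rsubmx _)
    (differentiable_coord _ _ _)).
rewrite /derive; apply: cvg_lim => //.
(* By linearity the difference quotient is constant for [h] different from 0. *)
apply: cvg_near_cst; near=> h.
rewrite /= !mxE addrK [_ *: _]mulrA mulVf ?mul1r //.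
by near: h; exact: nbhs_dnbhs_neq.
Unshelve. all: by end_near. Qed.

End Smooth.

Lemma differentiable_comp_lsubmx (R : realType) (n1 n2 : nat)
    (f : 'rV[R]_n1 -> R) (q : 'rV[R]_(n1 + n2)) :
  differentiable f (lsubmx q) -> differentiable (fun q => f (lsubmx q)) q.
Proof.
by move=> df; apply: differentiable_comp => //; exact: differentiable_lsubmx.
Qed.

(** * Jacobi operators of connections with parallel null verticals *)

Lemma lsubmx_delta_lshift (R : pzSemiRingType) (m n : nat) (k : 'I_m) :
  lsubmx (delta_mx 0 (lshift n k)) = delta_mx 0 k :> 'rV[R]_m.
Proof. by apply/rowP => i; rewrite !mxE eq_lshift. Qed.

Lemma lsubmx_delta_rshift (R : pzSemiRingType) (m n : nat) (k : 'I_n) :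
  lsubmx (delta_mx 0 (rshift m k)) = 0 :> 'rV[R]_m.
Proof. by apply/rowP => i; rewrite !mxE eq_lrshift andbF. Qed.

Lemma rsubmx_delta_rshift (R : pzSemiRingType) (m n : nat) (k : 'I_n) :
  rsubmx (delta_mx 0 (rshift m k)) = delta_mx 0 k :> 'rV[R]_n.
Proof. by apply/rowP => i; rewrite !mxE eq_rshift. Qed.

(** * Contraction of three-index arrays and the Jacobi operator in coordinates *)

Section Contraction.
Variables (R : comNzRingType) (m : nat).

(** [T] will be the array of Christoffel symbols at a point or of their derivatives along a vector;
    the last index is that of the resulting vector. *)
Definition tensor_form (T : 'I_m -> 'I_m -> 'I_m -> R) (X Y : 'rV[R]_m) :
    'rV[R]_m :=
  \row_k \sum_i \sum_j X 0 i * Y 0 j * T i j k.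

Lemma tensor_formBl T X X' Y :
  tensor_form T (X - X') Y = tensor_form T X Y - tensor_form T X' Y.
Proof.
apply/rowP => k; rewrite !mxE -sumrB; apply: eq_bigr => i _.
by rewrite -sumrB; apply: eq_bigr => j _; rewrite !mxE; ring.
Qed.

Lemma tensor_formBr T X Y Y' :
  tensor_form T X (Y - Y') = tensor_form T X Y - tensor_form T X Y'.
Proof.
apply/rowP => k; rewrite !mxE -sumrB; apply: eq_bigr => i _.
by rewrite -sumrB; apply: eq_bigr => j _; rewrite !mxE; ring.
Qed.

Lemma tensor_form_tensorB T T' T'' X Y :
  (forall i j k, T i j k = T' i j k - T'' i j k) ->
  tensor_form T X Y = tensor_form T' X Y - tensor_form T'' X Y.
Proof.
move=> TE; apply/rowP => k; rewrite !mxE -sumrB; apply: eq_bigr => i _.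
by rewrite -sumrB; apply: eq_bigr => j _; rewrite TE; ring.
Qed.

Lemma tensor_form0l T Y : tensor_form T 0 Y = 0.
Proof. by rewrite -(subrr Y) tensor_formBl !subrr. Qed.

Lemma tensor_form0r T X : tensor_form T X 0 = 0.
Proof. by rewrite -(subrr X) tensor_formBr !subrr. Qed.

Lemma tensor_form_delta T i Y k :
  tensor_form T (delta_mx 0 i) Y 0 k = \sum_j Y 0 j * T i j k.
Proof.
rewrite mxE (bigD1 i) //= [X in _ + X]big1 ?addr0; last first.
  by move=> l /negbTE li; rewrite big1 // => j _; rewrite mxE li andbF !mul0r.
by apply: eq_bigr => j _; rewrite mxE !eqxx mul1r.
Qed.

End Contraction.

(** For fields with constant components the bracket vanishes and [nabla] reduces to a contraction
    with the symbols. Applying [nabla] once more yields a derivative of the symbols and a quadratic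
    term. *)
Lemma jacobi_tensor_form (R : realType) (m : nat) (g : 'rV[R]_m -> 'M[R]_m)
    (p x y : 'rV[R]_m) (L := levi_civita g)
    (dL := fun v i j k => 'D_v (fun q => L q i j k) p) :
  (forall i j k, differentiable (fun q => L q i j k) p) ->
  jacobi g p x y = tensor_form (dL y) x x - tensor_form (dL x) y x +
    tensor_form (L p) y (tensor_form (L p) x x) -
    tensor_form (L p) x (tensor_form (L p) y x).
Proof.
move=> dfL.
have nablaE X Y q : nabla g (fun=> X) (fun=> Y) q = tensor_form (L q) X Y.
  by rewrite /nabla derive_cst add0r.
have dC v X Y :
    'D_v (fun q => tensor_form (L q) X Y) p = tensor_form (dL v) X Y.
  have dk k : is_derive p v (fun q => tensor_form (L q) X Y 0 k)
      (tensor_form (dL v) X Y 0 k).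
    under eq_fun do rewrite mxE.
    rewrite mxE; apply: is_derive_bigsum => i; apply: is_derive_bigsum => j.
    by apply: is_derive_cstM; apply: derivableP; exact: diff_derivable.
  rewrite derive_mx; last first.
    by apply/derivable_mxP => i k; rewrite ord1; case: (dk k).
  by apply/rowP => k; rewrite mxE derive_val.
have nablaF v F : nabla g (fun=> v) F p = 'D_v F p + tensor_form (L p) v (F p).
  by [].
rewrite /jacobi /curvature !nablaF.
have nablaC X Y : nabla g (fun=> X) (fun=> Y) = fun q => tensor_form (L q) X Y.
  exact/funext/nablaE.
have -> : lie_bracket (fun=> y) (fun=> x) = fun=> 0 :> 'rV[R]_m.
  by apply/funext => q; rewrite /lie_bracket !derive_cst subrr.
rewrite !nablaC !dC tensor_form0l subr0.
by rewrite opprD addrACA !derive_cst !add0r addrA.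
Qed.

(** * Difference of two Jacobi operators along a vertical vector *)

Section VerticalTensor.
Variables (R : fieldType) (n : nat).
Implicit Types (T : 'I_(n + n) -> 'I_(n + n) -> 'I_(n + n) -> R).
Implicit Types (X Y : 'rV[R]_(n + n)).

(* Contracting T with a vertical vector gives a vertical vector, and with two
   vertical vectors 0. *)
Definition vertical_tensor T :=
  [/\ forall i j k, T (rshift n i) j (lshift n k) = 0,
      forall i j k, T i (rshift n j) (lshift n k) = 0 &
      forall i j k, T (rshift n i) (rshift n j) k = 0].

Lemma lsubmx0P X : lsubmx X = 0 <-> forall i, X 0 (lshift n i) = 0.
Proof.
split=> [X0 i|X0]; first by have /rowP/(_ i) := X0; rewrite !mxE.
by apply/rowP => i; rewrite !mxE.
Qed.

Lemma tensor_form_vertical_l T X Y : vertical_tensor T -> lsubmx X = 0 ->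
  lsubmx (tensor_form T X Y) = 0.
Proof.
move=> [T1 _ _] /lsubmx0P X0; apply/lsubmx0P => k; rewrite mxE.
rewrite big_split_ord /= !big1 ?addr0 // => i _; rewrite big1 // => j _.
  by rewrite T1 mulr0.
by rewrite X0 !mul0r.
Qed.

Lemma tensor_form_vertical_r T X Y : vertical_tensor T -> lsubmx Y = 0 ->
  lsubmx (tensor_form T X Y) = 0.
Proof.
move=> [_ T2 _] /lsubmx0P Y0; apply/lsubmx0P => k; rewrite mxE.
rewrite big1 // => i _; rewrite big_split_ord /= !big1 ?addr0 // => j _.
  by rewrite T2 mulr0.
by rewrite Y0 mulr0 mul0r.
Qed.

Lemma tensor_form_vertical T X Y : vertical_tensor T -> lsubmx X = 0 ->
  lsubmx Y = 0 -> tensor_form T X Y = 0.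
Proof.
move=> [_ _ T3] /lsubmx0P X0 /lsubmx0P Y0; apply/rowP => k; rewrite !mxE.
rewrite big_split_ord /= !big1 ?addr0 // => i _; last first.
  by rewrite big1 // => j _; rewrite X0 !mul0r.
rewrite big_split_ord /= !big1 ?addr0 // => j _; first by rewrite T3 mulr0.
by rewrite Y0 mulr0 mul0r.
Qed.

Variables (L : 'I_(n + n) -> 'I_(n + n) -> 'I_(n + n) -> R)
  (dL : 'rV[R]_(n + n) -> 'I_(n + n) -> 'I_(n + n) -> 'I_(n + n) -> R).
Hypothesis LV : vertical_tensor L.
Hypothesis dLV : forall v, vertical_tensor (dL v).
Hypothesis dLB : forall v v' i j k,
  dL (v - v') i j k = dL v i j k - dL v' i j k.

(** Right-hand side of [jacobi_tensor_form]: [L] plays the Christoffel symbols at a point, [dL v]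
    their derivative along [v]. *)
Let J (x y : 'rV[R]_(n + n)) :=
  tensor_form (dL y) x x - tensor_form (dL x) y x +
  tensor_form L y (tensor_form L x x) - tensor_form L x (tensor_form L y x).

Let jacobi_diff (x y w : 'rV[R]_(n + n)) :
  J x y - J (x - w) y =
  tensor_form (dL y) x w + tensor_form (dL y) w x - tensor_form (dL y) w w -
  (tensor_form (dL x) y w + tensor_form (dL w) y x - tensor_form (dL w) y w) +
  (tensor_form L y (tensor_form L x w) + tensor_form L y (tensor_form L w x)
   - tensor_form L y (tensor_form L w w)) -
  (tensor_form L x (tensor_form L y w) + tensor_form L w (tensor_form L y x) -
   tensor_form L w (tensor_form L y w)).
Proof.
rewrite /J !(tensor_form_tensorB _ _ (dLB x w)) !(tensor_formBl, tensor_formBr).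
(* Each contraction is generalized to a variable, which leaves a linear identity for [ring]. *)
repeat match goal with
  |- context[tensor_form ?T ?X ?Y] => move: (tensor_form T X Y) => ? end.
by apply/rowP => k; rewrite !mxE; ring.
Qed.

Let vl T X Y (VT : vertical_tensor T) (X0 : lsubmx X = 0) :=
  tensor_form_vertical_l Y VT X0.
Let vr T X Y (VT : vertical_tensor T) (Y0 : lsubmx Y = 0) :=
  tensor_form_vertical_r X VT Y0.

(** In every other term of [jacobi_diff] the vector [w] is an argument of some contraction, and
    verticality passes from there to the outermost one. *)
Lemma jacobi_diff_horizontal (x y w : 'rV[R]_(n + n)) : lsubmx w = 0 ->
  lsubmx (J x y - J (x - w) y) = - lsubmx (tensor_form (dL w) y x).
Proof.
move=> w0; rewrite jacobi_diff.
have Lyxw : lsubmx (tensor_form L y (tensor_form L x w)) = 0 by apply/vr/vr.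
have Lywx : lsubmx (tensor_form L y (tensor_form L w x)) = 0 by apply/vr/vl.
have Lyww : lsubmx (tensor_form L y (tensor_form L w w)) = 0 by apply/vr/vl.
have Lxyw : lsubmx (tensor_form L x (tensor_form L y w)) = 0 by apply/vr/vr.
rewrite !(raddfB, raddfD) /= Lyxw Lywx Lyww Lxyw !(@vr (dL _) _ w) //.
rewrite !(@vl L w) // (@vl (dL y) w) //.
by rewrite !(oppr0, addr0, add0r).
Qed.

(** With [y] vertical too, every quadratic term either contracts two vertical vectors or contains
    such a contraction; so all of them vanish. *)
Lemma jacobi_diff_vertical (x y w : 'rV[R]_(n + n)) :
  lsubmx w = 0 -> lsubmx y = 0 ->
  J x y - J (x - w) y =
  tensor_form (dL y) x w + tensor_form (dL y) w x - tensor_form (dL w) y x.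
Proof.
move=> w0 y0; rewrite jacobi_diff.
rewrite (@tensor_form_vertical (dL y) w w) //.
rewrite (@tensor_form_vertical (dL x) y w) //.
rewrite (@tensor_form_vertical (dL w) y w) // (@tensor_form_vertical L w w) //.
rewrite (@tensor_form_vertical L y w) // !tensor_form0r.
have Lyxw : tensor_form L y (tensor_form L x w) = 0.
  by apply: tensor_form_vertical => //; exact: vr.
have Lywx : tensor_form L y (tensor_form L w x) = 0.
  by apply: tensor_form_vertical => //; exact: vl.
have Lwyx : tensor_form L w (tensor_form L y x) = 0.
  by apply: tensor_form_vertical => //; exact: vl.
rewrite Lyxw Lywx Lwyx.
by rewrite !(addr0, add0r, subr0).
Qed.

Let y (v : 'rV[R]_(n + n)) (i : 'I_n) : R := rsubmx v 0 i.

(** This and the next two are the vertical derivatives of the symbols of [g_N]. They come from the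
    part [x_i' x_j'] of the metric alone: the part linear in [x_k'] becomes constant along the
    fibres after one vertical derivative. *)
Hypothesis dL_horizontal : forall v k i j, lsubmx v = 0 ->
  dL v (lshift n i) (lshift n j) (lshift n k) =
  - 2^-1 * ((i == k)%:R * y v j + y v i * (j == k)%:R).
Hypothesis dL_vertical_rl : forall v k i j, lsubmx v = 0 ->
  dL v (rshift n i) (lshift n j) (rshift n k) =
  2^-1 * ((j == i)%:R * y v k + y v j * (k == i)%:R).
Hypothesis dL_vertical_lr : forall v k i j, lsubmx v = 0 ->
  dL v (lshift n j) (rshift n i) (rshift n k) =
  2^-1 * ((j == i)%:R * y v k + y v j * (k == i)%:R).

Let sum_delta (f : 'I_n -> R) k : \sum_j f j * (j == k)%:R = f k.
Proof.
rewrite (bigD1 k) //= eqxx mulr1 big1 ?addr0 // => j /negbTE ->.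
by rewrite mulr0.
Qed.

Variables (x w : 'rV[R]_(n + n)).
Hypotheses (w_vertical : lsubmx w = 0)
  (xw1 : lsubmx x *m (rsubmx w)^T = 1%:M).

Let a := lsubmx x.
Let b := rsubmx w.

Let xw_sum : \sum_j x 0 (lshift n j) * y w j = 1.
Proof.
have /matrixP/(_ 0 0) := xw1; rewrite !mxE eqxx mulr1n => <-.
by apply: eq_bigr => j _; rewrite /y !mxE.
Qed.

Let rank1E i k : (2^-1%:M + 2^-1 *: (b^T *m a)) i k =
  2^-1 * ((i == k)%:R + y w i * x 0 (lshift n k)).
Proof.
by rewrite /y /a /b !mxE big_ord1 !mxE mulrDr mulr_natr.
Qed.

Let dJ z := J x z - J (x - w) z.

(** In the sum over [j], the term with [i == k] carries the pairing of [x] with [w], which is 1; in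
    the other one the Kronecker delta selects [x 0 (lshift n k)]. *)
Let dJ_ul i k : dJ (delta_mx 0 (lshift n i)) 0 (lshift n k) =
  2^-1 * ((i == k)%:R + y w i * x 0 (lshift n k)).
Proof.
have lE (X : 'rV[R]_(n + n)) : X 0 (lshift n k) = lsubmx X 0 k by rewrite mxE.
rewrite /dJ [LHS]lE jacobi_diff_horizontal // mxE [lsubmx _ _ _]mxE.
rewrite tensor_form_delta big_split_ord /=.
rewrite [X in _ + X]big1 ?addr0 => [|j _]; last first.
  by have [_ -> _] := dLV w; rewrite mulr0.
under eq_bigr => j _.
  rewrite (dL_horizontal _ _ _ w_vertical).
  have -> : x 0 (lshift n j) *
        (- 2^-1 * ((i == k)%:R * y w j + y w i * (j == k)%:R)) =
      - (2^-1 * (i == k)%:R) * (x 0 (lshift n j) * y w j) +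
      - (2^-1 * y w i) * (x 0 (lshift n j) * (j == k)%:R) by ring.
  over.
rewrite big_split /= -!mulr_sumr xw_sum (sum_delta (fun j => x 0 (lshift n j))).
by ring.
Qed.

Let dJ_dl i k : dJ (delta_mx 0 (rshift n i)) 0 (lshift n k) = 0.
Proof.
have lE (X : 'rV[R]_(n + n)) : X 0 (lshift n k) = lsubmx X 0 k by rewrite mxE.
rewrite /dJ [LHS]lE jacobi_diff_horizontal //.
rewrite tensor_form_vertical_l ?oppr0 ?mxE //.
exact: lsubmx_delta_rshift.
Qed.

(** The three terms left by [jacobi_diff_vertical] have the same value. Two enter with sign plus and
    one with minus, so one copy remains, the transpose of [dJ_ul]. *)
Let dJ_dr i k : dJ (delta_mx 0 (rshift n i)) 0 (rshift n k) =
  2^-1 * ((k == i)%:R + y w k * x 0 (lshift n i)).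
Proof.
set e := delta_mx 0 (rshift n i).
have e0 : lsubmx e = 0 by exact: lsubmx_delta_rshift.
have ye l : y e l = (l == i)%:R by rewrite /y rsubmx_delta_rshift mxE eqxx.
have wl l : w 0 (lshift n l) = 0.
  by have /rowP/(_ l) := w_vertical; rewrite !mxE.
have wr l : w 0 (rshift n l) = y w l by rewrite /y mxE.
have [_ _ rr] := dLV e; have [_ _ rrw] := dLV w.
have dLe1 : tensor_form (dL e) x w 0 (rshift n k) =
    2^-1 * ((k == i)%:R + y w k * x 0 (lshift n i)).
  rewrite mxE big_split_ord /= [X in _ + X]big1 ?addr0 => [|j _]; last first.
    rewrite big_split_ord /= !big1 ?addr0 // => l _; first by rewrite rr mulr0.
    by rewrite wl mulr0 mul0r.
  under eq_bigr => j _.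
    rewrite big_split_ord /= [X in X + _]big1 ?add0r => [|l _]; last first.
      by rewrite wl mulr0 mul0r.
    under eq_bigr => l _.
      rewrite (dL_vertical_lr _ _ _ e0) !ye wr.
      have -> : x 0 (lshift n j) * y w l *
          (2^-1 * ((j == l)%:R * (k == i)%:R + (j == i)%:R * (k == l)%:R)) =
        2^-1 * x 0 (lshift n j) * (k == i)%:R * (y w l * (l == j)%:R) +
        2^-1 * x 0 (lshift n j) * (j == i)%:R * (y w l * (l == k)%:R).
        by rewrite [l == j]eq_sym [l == k]eq_sym; ring.
      over.
    rewrite big_split /= -!mulr_sumr !sum_delta.
    have -> : 2^-1 * x 0 (lshift n j) * (k == i)%:R * y w j +
       2^-1 * x 0 (lshift n j) * (j == i)%:R * y w k =
       2^-1 * (k == i)%:R * (x 0 (lshift n j) * y w j) +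
       2^-1 * y w k * (x 0 (lshift n j) * (j == i)%:R) by ring.
    over.
  rewrite big_split /= -!mulr_sumr xw_sum.
  rewrite (sum_delta (fun j => x 0 (lshift n j))).
  by ring.
have dLe2 : tensor_form (dL e) w x 0 (rshift n k) =
    tensor_form (dL e) x w 0 (rshift n k).
  rewrite !mxE exchange_big /=; apply: eq_bigr => l _; apply: eq_bigr => j _.
  case: (split_ordP j) => j' ->; first by rewrite wl mulr0 !mul0r.
  case: (split_ordP l) => l' ->; last by rewrite !rr !mulr0.
  by rewrite dL_vertical_rl // dL_vertical_lr // [w _ _ * _]mulrC.
have dLw : tensor_form (dL w) e x 0 (rshift n k) =
    2^-1 * ((k == i)%:R + y w k * x 0 (lshift n i)).
  rewrite tensor_form_delta big_split_ord /= [X in _ + X]big1 ?addr0; last first.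
    by move=> j _; rewrite rrw mulr0.
  under eq_bigr => j _.
    rewrite (dL_vertical_rl _ _ _ w_vertical).
    have -> : x 0 (lshift n j) *
          (2^-1 * ((j == i)%:R * y w k + y w j * (k == i)%:R)) =
       2^-1 * (k == i)%:R * (x 0 (lshift n j) * y w j) +
       2^-1 * y w k * (x 0 (lshift n j) * (j == i)%:R) by ring.
    over.
  rewrite big_split /= -!mulr_sumr xw_sum.
  rewrite (sum_delta (fun j => x 0 (lshift n j))).
  by ring.
have addE (X Y : 'rV[R]_(n + n)) l : (X + Y) 0 l = X 0 l + Y 0 l by rewrite mxE.
have oppE (X : 'rV[R]_(n + n)) l : (- X) 0 l = - X 0 l by rewrite mxE.
by rewrite /dJ jacobi_diff_vertical // !addE oppE dLe2 dLe1 dLw addrK.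
Qed.

Lemma tensor_form_diff_rank1_block :
  exists B, lin1_mx dJ = rank1_block a b B.
Proof.
exists (ursubmx (lin1_mx dJ)); rewrite -[LHS]submxK /rank1_block.
congr block_mx; apply/matrixP => i k.
- by rewrite rank1E [LHS]mxE [LHS]mxE [LHS]mxE dJ_ul.
- by rewrite [RHS]mxE [LHS]mxE [LHS]mxE [LHS]mxE dJ_dl.
- by rewrite [RHS]mxE rank1E [LHS]mxE [LHS]mxE [LHS]mxE dJ_dr.
Qed.

End VerticalTensor.

(** * The modified Riemannian extension *)

Section ExtensionMetric.
Variables (R : realType) (n : nat) (M : manifold R n) (D : connection M).
Variable c : atlas M.

Let over (q : 'rV[R]_(n + n)) : Prop := chart_image c (lsubmx q).
(** The upper index comes first here, unlike in [Dchristoffel]. *)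
Let Gam (k i j : 'I_n) (x : 'rV[R]_n) : R := Dchristoffel D c x i j k.
Let y (q : 'rV[R]_(n + n)) (i : 'I_n) : R := rsubmx q 0 i.

Lemma smooth_Dchristoffel (i j k : 'I_n) :
  smooth (chart_image c) (fun x => Dchristoffel D c x i j k).
Proof.
have sc (v : 'rV[R]_n) : smooth_map (chart_image c) (fun=> v).
  by move=> l; exact: smooth_cst.
exact: (cov_smooth D (@chart_open _ _ M c) (@subset_refl _ _) (sc _) (sc _)).
Qed.

Let near_over q : over q -> \forall q' \near q, over q'.
Proof.
move=> qU.
have : {for q, continuous (lsubmx : 'rV[R]_(n + n) -> 'rV[R]_n)}.
  exact/differentiable_continuous/differentiable_lsubmx.
by apply; exact: open_nbhs_nbhs (conj (@chart_open _ _ M c) qU).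
Qed.

Let differentiable_Gam q k i j : over q ->
  differentiable (fun q => Gam k i j (lsubmx q)) q.
Proof.
move=> qU; apply: differentiable_comp_lsubmx.
apply: smooth_differentiable (@chart_open _ _ M c) _ qU.
exact: smooth_Dchristoffel.
Qed.

Let differentiable_DGam q k i j l : over q ->
  differentiable (fun q => 'D_(delta_mx 0 l) (Gam k i j) (lsubmx q)) q.
Proof.
move=> qU.
apply: (differentiable_comp_lsubmx (f := 'D_(delta_mx 0 l) (Gam k i j))).
apply: smooth_differentiable (@chart_open _ _ M c) _ qU.
exact: smooth_partial (smooth_Dchristoffel i j k).
Qed.

Let differentiable_y q i : differentiable (fun q => y q i) q.
Proof.
exact: (differentiable_comp (differentiable_rsubmx _)
  (differentiable_coord _ _ _)).
Qed.

(** The derivative of [extension_form] along [v], written as an explicit function of [q] so that it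
    can be differentiated again. *)
Let dE (v : 'rV[R]_(n + n)) (i j : 'I_n) (q : 'rV[R]_(n + n)) : R :=
  y v i * y q j + y q i * y v j -
  2 * \sum_l (y v l * Gam l i j (lsubmx q) +
              y q l * 'D_(lsubmx v) (Gam l i j) (lsubmx q)).

Let is_derive_E q v i j : over q ->
  is_derive q v (fun q => extension_form D c q i j) (dE v i j q).
Proof.
move=> qU.
have -> : (fun q => extension_form D c q i j) =
    (fun q => y q i * y q j - 2 * \sum_k y q k * Gam k i j (lsubmx q)).
  by apply/funext => q'; rewrite mxE.
have yP k := is_derive_rsubmx_coord k q v.
have sP : is_derive q v (fun q => \sum_k y q k * Gam k i j (lsubmx q))
   (\sum_l (y v l * Gam l i j (lsubmx q) +
              y q l * 'D_(lsubmx v) (Gam l i j) (lsubmx q))).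
  apply: is_derive_bigsum => k.
  have GP : is_derive q v (fun q => Gam k i j (lsubmx q))
      ('D_(lsubmx v) (Gam k i j) (lsubmx q)).
    rewrite -derive_comp_lsubmx; apply: derivableP; apply: diff_derivable.
    exact: differentiable_Gam.
  by apply: is_derive_eq (is_deriveM (yP k) GP) _; rewrite addrC mulrC.
apply: is_derive_eq
  (is_deriveB (is_deriveM (yP i) (yP j)) (is_derive_cstM 2 sP)) _.
by rewrite /dE /GRing.scale /=; congr (_ - _); rewrite addrC mulrC.
Qed.

Let differentiable_E q i j : over q ->
  differentiable (fun q => extension_form D c q i j) q.
Proof.
move=> qU; under eq_fun do rewrite mxE.
apply: differentiableB.
  by apply: differentiableM; exact: differentiable_y.
apply: differentiableM; first exact: differentiable_cst.
apply: differentiable_bigsum => k.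
by apply: differentiableM; [exact: differentiable_y|exact: differentiable_Gam].
Qed.

Let pg := partial_g (gN D c).

(** Outside its upper left block the matrix [gN] is constant. *)
Let pg0r a b k q : pg a b (rshift n k) q = 0.
Proof.
rewrite /pg /partial_g; case: (split_ordP b) => i ->.
  under eq_fun do rewrite block_mxEur; exact: derive_cst.
by under eq_fun do rewrite block_mxEdr; exact: derive_cst.
Qed.

Let pg0l a b k q : pg a (rshift n k) b q = 0.
Proof.
rewrite /pg /partial_g; case: (split_ordP b) => i ->.
  under eq_fun do rewrite block_mxEdl; exact: derive_cst.
by under eq_fun do rewrite block_mxEdr; exact: derive_cst.
Qed.

Let pgE a i j q : over q ->
  pg a (lshift n i) (lshift n j) q = dE (delta_mx 0 a) i j q.
Proof.
move=> qU; rewrite /pg /partial_g; under eq_fun do rewrite block_mxEul.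
by have := is_derive_E (delta_mx 0 a) i j qU => ?; rewrite derive_val.
Qed.

(** A vertical direction fixes the base point, so the connection term is differentiated only through
    its factor [x_k']. *)
Let pg_vertical k i j q : over q ->
  pg (rshift n k) (lshift n i) (lshift n j) q =
  (i == k)%:R * y q j + y q i * (j == k)%:R - 2 * Gam k i j (lsubmx q).
Proof.
move=> qU; rewrite pgE // /dE lsubmx_delta_rshift.
rewrite /y rsubmx_delta_rshift !mxE !eqxx /=; congr (_ - 2 * _).
rewrite (bigD1 k) //= derive0 mulr0 addr0 mxE !eqxx mul1r.
rewrite big1 ?addr0 // => l lk.
by rewrite derive0 mulr0 addr0 mxE (negbTE lk) andbF mul0r.
Qed.

Let differentiable_pg a b d q : over q -> differentiable (pg a b d) q.
Proof.
move=> qU.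
case: (split_ordP b) => i ->; case: (split_ordP d) => j ->; first last.
- by rewrite (_ : pg _ _ _ = cst 0); [exact: differentiable_cst|exact/funext].
- by rewrite (_ : pg _ _ _ = cst 0); [exact: differentiable_cst|exact/funext].
- by rewrite (_ : pg _ _ _ = cst 0); [exact: differentiable_cst|exact/funext].
apply: (@near_eq_differentiable _ _ _ (dE (delta_mx 0 a) i j)).
  by have := near_over qU; apply: filterS => q' /pgE->.
apply: differentiableB.
  apply: differentiableD; apply: differentiableM => //; exact: differentiable_cst.
apply: differentiableM; first exact: differentiable_cst.
apply: differentiable_bigsum => l; apply: differentiableD.
  apply: differentiableM; first exact: differentiable_cst.
  exact: differentiable_Gam.
apply: differentiableM => //; case: (split_ordP a) => h ->.
  by rewrite lsubmx_delta_lshift; exact: differentiable_DGam.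
rewrite lsubmx_delta_rshift; under eq_fun do rewrite derive0.
exact: differentiable_cst.
Qed.

(** * Inverse metric and Levi-Civita symbols *)

Let invmx_gN q :
  invmx (gN D c q) = block_mx 0 1%:M 1%:M (- extension_form D c q).
Proof.
set B := RHS; have gB : gN D c q *m B = 1%:M.
  rewrite mulmx_block !mulmx0 !mulmx1 !mul1mx mul0mx !addr0 add0r addrN.
  by rewrite -scalar_mx_block.
by rewrite -[LHS]mulmx1 -gB mulKmx //; have [] := mulmx1_unit gB.
Qed.

Let L := levi_civita (gN D c).

(** In column [lshift n k] of the inverse metric only the entry in row [rshift n k] is nonzero, and
    two of the three metric derivatives with that index vanish. *)
Let L_horizontal q a b k :
  L q a b (lshift n k) = - 2^-1 * pg (rshift n k) a b q.
Proof.
rewrite /L /levi_civita invmx_gN big_split_ord /= big1 ?add0r; last first.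
  by move=> l _; rewrite block_mxEul mxE mulr0.
rewrite mulNr -mulrN; congr (_ * _); rewrite (bigD1 k) //= big1 => [|l lk].
  by rewrite block_mxEdl mxE eqxx mulr1 addr0 -!/(pg _ _ _ _) !pg0r addr0 sub0r.
by rewrite block_mxEdl mxE (negbTE lk) mulr0.
Qed.

Let L_vertical q a b k : L q a b (rshift n k) =
  2^-1 * (pg a b (lshift n k) q + pg b a (lshift n k) q - pg (lshift n k) a b q +
    \sum_l pg (rshift n l) a b q * extension_form D c q l k).
Proof.
rewrite /L /levi_civita invmx_gN big_split_ord /=; congr (_ * (_ + _)).
  rewrite (bigD1 k) //= big1 => [|l lk].
    by rewrite block_mxEur mxE eqxx mulr1 addr0.
  by rewrite block_mxEur mxE (negbTE lk) mulr0.
apply: eq_bigr => l _.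
by rewrite block_mxEdr mxE -!/(pg _ _ _ _) !pg0r addr0 sub0r mulrNN.
Qed.

Let L_vertical_rl q k i j :
  L q (rshift n i) (lshift n j) (rshift n k) =
  2^-1 * pg (rshift n i) (lshift n j) (lshift n k) q.
Proof.
rewrite L_vertical !pg0l addr0 subr0 big1 ?addr0 // => l _.
by rewrite pg0l mul0r.
Qed.

Let L_vertical_lr q k i j :
  L q (lshift n j) (rshift n i) (rshift n k) =
  2^-1 * pg (rshift n i) (lshift n j) (lshift n k) q.
Proof.
rewrite L_vertical pg0l !pg0r add0r subr0 big1 ?addr0 // => l _.
by rewrite pg0r mul0r.
Qed.

Let L_vertical_rr q k i j : L q (rshift n i) (rshift n j) k = 0.
Proof.
case: (split_ordP k) => h ->.
  by rewrite L_horizontal pg0l mulr0.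
rewrite L_vertical !pg0l !addr0 oppr0 big1 ?addr0 ?mulr0 // => l _.
by rewrite pg0l mul0r.
Qed.

(** In particular the vertical distribution is parallel; this reflects the constant vertical rows
    and columns of the metric. *)
Let L_tensor q : vertical_tensor (L q).
Proof.
split=> i j k; last exact: L_vertical_rr.
  by rewrite L_horizontal pg0l mulr0.
by rewrite L_horizontal pg0r mulr0.
Qed.

Let differentiable_L a b d q : over q -> differentiable (fun q => L q a b d) q.
Proof.
move=> qU; case: (split_ordP d) => k ->.
  under eq_fun do rewrite L_horizontal.
  apply: differentiableM; first exact: differentiable_cst.
  exact: differentiable_pg.
under eq_fun do rewrite L_vertical.
apply: differentiableM; first exact: differentiable_cst.
apply: differentiableD.
  apply: differentiableB; last exact: differentiable_pg.
  by apply: differentiableD; exact: differentiable_pg.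
apply: differentiable_bigsum => l.
by apply: differentiableM; [exact: differentiable_pg|exact: differentiable_E].
Qed.

(** * Vertical derivatives of the symbols at a point *)

Section AtPoint.
Variables (p : 'rV[R]_(n + n)) (p_over : over p).

Let dL v i j k := 'D_v (fun q => L q i j k) p.

Let dL_tensor v : vertical_tensor (dL v).
Proof.
have z i j k : (forall q, L q i j k = 0) -> dL v i j k = 0.
  by move=> L0; rewrite /dL; under eq_fun do rewrite L0; exact: derive_cst.
by split=> i j k; apply: z => q; have [L1 L2 L3] := L_tensor q.
Qed.

(** Linearity in the direction rests on Fréchet differentiability of the symbols, for which mere
    directional derivatives would not do. *)
Let dLB v v' i j k : dL (v - v') i j k = dL v i j k - dL v' i j k.
Proof. by rewrite /dL !deriveE ?linearB //; exact: differentiable_L. Qed.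

Let is_derive_pg_vertical v k i j : lsubmx v = 0 ->
  is_derive p v (pg (rshift n k) (lshift n i) (lshift n j))
    ((i == k)%:R * y v j + y v i * (j == k)%:R).
Proof.
move=> v0.
have yP l := is_derive_rsubmx_coord l p v.
have GP : is_derive p v (fun q => Gam k i j (lsubmx q)) 0.
  split; first exact/diff_derivable/differentiable_Gam.
  by rewrite derive_comp_lsubmx v0 derive0.
have fP : is_derive p v
    (fun q => (i == k)%:R * y q j + (j == k)%:R * y q i -
              2 * Gam k i j (lsubmx q))
    ((i == k)%:R * y v j + y v i * (j == k)%:R).
  apply: is_derive_eq (is_deriveB (is_deriveD (is_derive_cstM _ (yP j))
    (is_derive_cstM _ (yP i))) (is_derive_cstM 2 GP)) _.
  by rewrite mulr0 subr0 [_ * rsubmx v 0 i]mulrC.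
apply: near_eq_is_derive fP; have := near_over p_over; apply: filterS => q qU.
by rewrite pg_vertical // [y q i * _]mulrC.
Qed.

Let dL_horizontal v k i j : lsubmx v = 0 ->
  dL v (lshift n i) (lshift n j) (lshift n k) =
  - 2^-1 * ((i == k)%:R * y v j + y v i * (j == k)%:R).
Proof.
move=> /(is_derive_pg_vertical k i j) P; rewrite /dL.
under eq_fun do rewrite L_horizontal.
by have := is_derive_cstM (- 2^-1) P => ?; rewrite derive_val.
Qed.

Let dL_vertical_rl v k i j : lsubmx v = 0 ->
  dL v (rshift n i) (lshift n j) (rshift n k) =
  2^-1 * ((j == i)%:R * y v k + y v j * (k == i)%:R).
Proof.
move=> /(is_derive_pg_vertical i j k) P; rewrite /dL.
under eq_fun do rewrite L_vertical_rl.
by have := is_derive_cstM 2^-1 P => ?; rewrite derive_val.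
Qed.

Let dL_vertical_lr v k i j : lsubmx v = 0 ->
  dL v (lshift n j) (rshift n i) (rshift n k) =
  2^-1 * ((j == i)%:R * y v k + y v j * (k == i)%:R).
Proof.
move=> /(is_derive_pg_vertical i j k) P; rewrite /dL.
under eq_fun do rewrite L_vertical_lr.
by have := is_derive_cstM 2^-1 P => ?; rewrite derive_val.
Qed.

Lemma jacobi_diff_rank1_block (x w : 'rV[R]_(n + n)) :
  lsubmx w = 0 -> lsubmx x *m (rsubmx w)^T = 1%:M ->
  exists B,
    lin1_mx (fun z => jacobi (gN D c) p x z - jacobi (gN D c) p (x - w) z) =
    rank1_block (lsubmx x) (rsubmx w) B.
Proof.
move=> w0 xw1.
have [B BE] := tensor_form_diff_rank1_block (L_tensor p) dL_tensor dLB
  dL_horizontal dL_vertical_rl dL_vertical_lr w0 xw1.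
exists B; rewrite -BE; congr lin1_mx; apply/funext => z.
by rewrite !jacobi_tensor_form // => i j k; exact: differentiable_L.
Qed.

End AtPoint.
End ExtensionMetric.

(** * The para-complex Jacobi operator, its spectrum and its Jordan type *)

Lemma map_rank1_block (F K : fieldType) (f : {rmorphism F -> K}) (n : nat)
    (a c : 'rV[F]_n) (B : 'M[F]_n) :
  map_mx f (rank1_block a c B) =
  rank1_block (map_mx f a) (map_mx f c) (map_mx f B).
Proof.
rewrite /rank1_block map_block_mx map_mx0 -map_trmx map_mxD map_mxZ map_mxM.
by rewrite map_scalar_mx -map_trmx /= fmorphV rmorph_nat.
Qed.

(** The vector [2 *: b + a *m E] is the vertical part of [xi - J xi] for [xi = (a, b)], so a unit
    vector gives the normalization [a *m c^T = 1] of [rank1_block]. *)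
Lemma form_extension (R : realType) (n : nat) (E : 'M[R]_n) (a b : 'rV[R]_n) :
  Defs.form (block_mx E 1%:M 1%:M 0) (row_mx a b) (row_mx a b) =
  (a *m (2 *: b + a *m E)^T) 0 0.
Proof.
have dotC (u v : 'rV[R]_n) : u *m v^T = v *m u^T.
  rewrite -[in RHS](trmxK v) -trmx_mul; apply/matrixP => i j.
  by rewrite !ord1 [RHS]mxE.
rewrite /Defs.form mul_row_block !mulmx1 mulmx0 addr0 tr_row_mx mul_row_col.
rewrite mulmxDl (dotC b) dotC -addrA -mulr2n addrC -scaler_nat.
by rewrite linearD linearZ /= mulmxDr -scalemxAr.
Qed.

Lemma para_jacobi_rank1_block (R : realType) (n : nat) (M : manifold R n)
    (D : connection M) (pi : para_plane D) (xi : 'rV[R]_(n + n)) :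
  unit_vector pi xi ->
  exists a c B, a *m c^T = 1%:M /\ para_jacobi pi xi = rank1_block a c B.
Proof.
move=> [_]; set p := pl_pt pi => xi1.
set c := pl_chart pi in xi1 *; set J := JN D c p.
have p_over : chart_image c (lsubmx p).
  by rewrite row_mxKl; exists (foot (pt pi)) => //; exact: pl_dom.
(* Then [xi - w] is [xi *m J], as in [para_jacobi]; [w] is vertical because [J] preserves the
   horizontal components. *)
pose w := xi - xi *m J.
have xiE : xi = row_mx (lsubmx xi) (rsubmx xi) by rewrite hsubmxK.
have wE : w = row_mx 0 (2 *: rsubmx xi + lsubmx xi *m extension_form D c p).
  rewrite /w {1 2}xiE /J /JN mul_row_block mulmx1 mulmx0 addr0 opp_row_mx.
  rewrite add_row_mx.
  by rewrite subrr !mulmxN mulmx1 opprD !opprK addrA addrAC scaler_nat mulr2n.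
have w0 : lsubmx w = 0 by rewrite wE row_mxKl.
have w1 : lsubmx xi *m (rsubmx w)^T = 1%:M.
  rewrite wE row_mxKr; apply/matrixP => i j; rewrite !ord1.
  by rewrite [RHS]mxE eqxx mulr1n -[RHS]xi1 [in RHS]xiE form_extension.
have [B BE] := jacobi_diff_rank1_block D p_over w0 w1.
exists (lsubmx xi), (rsubmx w), B; split=> //; rewrite -BE.
by rewrite /w opprB addrC subrK.
Qed.

Theorem theorem1p3 (R : realType) (n : nat) (M : manifold R n)
    (D : connection M) :
  (forall (pi : para_plane D) (xi : 'rV[R]_(n + n)), unit_vector pi xi ->
     let A := complexify (para_jacobi pi xi) in
     [/\ forall z : R[i], eigenvalue A z -> z = 1 \/ z = 2^-1,
         multiplicity A 1 = 2%N,
         multiplicity A 2^-1 = (2 * n - 2)%N &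
         forall (s : nat) (k : 'I_s -> nat) (z : 'I_s -> R[i]),
           jordan_normal_form A k z -> forall i, (k i <= 2)%N]) /\
  semi_para_complex_osserman D.
Proof.
(* A 2-plane in a space of dimension [n + n] forces [n] to be positive. *)
have n_gt0 (pi : para_plane D) : (0 < n)%N.
  have := dimvS (subvf (plane pi)); rewrite plane_dim dimvf /dim /= mul1n.
  by move=> n2; rewrite lt0n; apply: contraTneq n2 => ->.
have two : 2 != 0 :> R[i] by rewrite pnatr_eq0.
have half : (2^-1 : R[i]) != 1.
  by rewrite invr_eq1 pnatr_eq1.
(* The rank-one form survives extension of scalars, so the real computation carries over to
   [R[i]]. *)
have jacobiE (pi : para_plane D) xi : unit_vector pi xi ->
    exists (a c : 'rV[R[i]]_n) B,
      a *m c^T = 1%:M /\ complexify (para_jacobi pi xi) = rank1_block a c B.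
  move=> /para_jacobi_rank1_block[a [c [B [ac ->]]]].
  exists (map_mx (real_complex R) a), (map_mx (real_complex R) c).
  exists (map_mx (real_complex R) B).
  rewrite map_trmx -map_mxM ac map_scalar_mx.
  by rewrite rmorph1 -map_rank1_block.
(* This polynomial depends on [n] only, which gives the Osserman property at once. *)
have charE (pi : para_plane D) xi : unit_vector pi xi ->
    char_poly (complexify (para_jacobi pi xi)) =
    ('X - 2^-1%:P) ^+ (2 * n - 2) * ('X - 1%:P) ^+ 2.
  move=> /jacobiE[a [c [B [ac ->]]]].
  exact: char_poly_rank1_block two ac (n_gt0 pi).
split=> [pi xi xi1 A|pi pi' xi xi' xi1 xi1' z]; last first.
  have AE := charE _ _ xi1; have AE' := charE _ _ xi1'.
  rewrite /multiplicity; apply: (congr1 (mup z)).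
  exact: etrans AE (esym AE').
have neq0 (z : R[i]) k : ('X - z%:P) ^+ k != 0.
  by rewrite expf_neq0 ?polyXsubC_eq0.
have AE := charE _ _ xi1; split.
- move=> z; rewrite eigenvalue_root_char AE rootM !rootE !horner_exp !expf_eq0.
  rewrite !hornerXsubC !subr_eq0 => /orP[] /andP[_ /eqP]; last by left.
  by right.
- by rewrite /multiplicity AE mupM // !mup_XsubCX eqxx (negbTE half).
- rewrite /multiplicity AE mupM // !mup_XsubCX eqxx eq_sym (negbTE half).
  by rewrite addn0.
- have [a [c [B [ac ABE]]]] := jacobiE _ _ xi1.
  apply: (@jordan_block_le2 _ _ A 1 2^-1); first by rewrite eq_sym.
  by rewrite /A ABE; exact: rank1_block_annihilated.
Qed.
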